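(* Let $E$ and $F$ be Banach spaces, where $E$ has a separable quotient, let $T:E\to F$ be a bounded linear operator with dense range, and let $R\in\mathcal R_d(E)$. If $T(E)$ is not closed, then there exists a closed subspace $X\subset E$ such that (a) $E/X$ is separable and infinite-dimensional; (b) $\mathrm{codim}_E(R+X)=\infty$; and (c) $T^*(F^* )\cap X^{\perp}=\{0\}$.
   Context: All spaces are real. A Banach space $E$ has a separable quotient if there is a closed subspace $N\subset E$ such that $E/N$ is infinite-dimensional and separable. A linear subspace $R\subset E$ is an operator range in $E$ if there exist a Banach space $G$ and a bounded linear operator $A:G\to E$ with $A(G)=R$. $\mathcal R_d(E)$ denotes the class of proper (i.e. $\neq E$) dense operator ranges in $E$. $T^*:F^*\to E^*$ is the adjoint of $T$, and $X^\perp=\{f\in E^*: f(x)=0 \text{ for all } x\in X\}$. *)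

(* Defs.v *)
From HB Require Import structures.
From mathcomp Require Import all_boot all_order all_algebra.
From mathcomp Require Import generic_quotient ring_quotient.
From mathcomp Require Import all_classical all_reals all_analysis.

Set Implicit Arguments.
Unset Strict Implicit.
Unset Printing Implicit Defensive.

Import Order.TTheory GRing.Theory Num.Theory.
Import numFieldNormedType.Exports.

Local Open Scope classical_set_scope.
Local Open Scope ring_scope.
Local Open Scope quotient_scope.

HB.mixin Record isClosedPred (T : topologicalType) (S : T -> bool) := {
  closed_pred_subproof : closed [set` S]
}.

#[short(type="closedSubspaceType")]
HB.structure Definition ClosedSubspace (K : numFieldType)
    (E : normedModType K) :=
  {S of GRing.SubmodClosed K S & isClosedPred E S}.

Section SumOfSubspaces.
Context (K : nzRingType) (E : lmodType K) (A B : submodClosed E).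

Definition subspace_sum_pred : {pred E} :=
  fun z => z \in [set a + b | a in [set` A] & b in [set` B]].

Lemma subspace_sumP z :
  reflect (exists a b, [/\ a \in A, b \in B & z = a + b])
          (z \in subspace_sum_pred).
Proof.
apply: (iffP idP) => [|[a [b [aA bB ->]]]].
  by rewrite /in_mem /= /subspace_sum_pred inE => -[a aA [b bB <-]]; exists a, b.
by rewrite /in_mem /= /subspace_sum_pred inE; exists a => //; exists b.
Qed.

Lemma subspace_sum_closed : GRing.subsemimod_closed subspace_sum_pred.
Proof.
split; [split|].
- by apply/subspace_sumP; exists 0, 0; rewrite !rpred0 addr0.
- move=> _ _ /subspace_sumP[a [b [aA bB ->]]] /subspace_sumP[c [d [cA dB ->]]].
  apply/subspace_sumP; exists (a + c), (b + d).
  by rewrite !rpredD// addrACA.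
- move=> k _ /subspace_sumP[a [b [aA bB ->]]].
  apply/subspace_sumP; exists (k *: a), (k *: b).
  by rewrite !rpredZ// scalerDr.
Qed.

HB.instance Definition _ :=
  GRing.isSubmodClosed.Build K E subspace_sum_pred subspace_sum_closed.

Definition subspace_sum : submodClosed E := subspace_sum_pred.

End SumOfSubspaces.

(* An alias of X that also receives the closure under opposites required by
   [Quotient.quot]; [submodClosed] only provides sums and scalings. *)
Definition submod_pred (K : nzRingType) (E : lmodType K)
  (X : submodClosed E) : {pred E} := X.

Section AlgebraicQuotient.
Context (K : nzRingType) (E : lmodType K) (X : submodClosed E).

HB.instance Definition _ := GRing.SubmodClosed.on (submod_pred X).

Lemma submod_oppr_closed : oppr_closed X.
Proof. by move=> x xX; rewrite -scaleN1r rpredZ. Qed.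

HB.instance Definition _ :=
  GRing.isOppClosed.Build E (submod_pred X) submod_oppr_closed.

Definition lquot := Quotient.quot (submod_pred X).

HB.instance Definition _ := GRing.Zmodule.on lquot.
HB.instance Definition _ : EqQuotient E (Quotient.equiv (submod_pred X)) lquot :=
  EqQuotient.on lquot.

Definition lquot_pi (x : E) : lquot := \pi_(Quotient.quot (submod_pred X)) x.

Lemma lquot_piE x y : lquot_pi x = lquot_pi y <-> x - y \in X.
Proof.
rewrite -[_ \in X]/(_ \in submod_pred X) Quotient.idealrBE.
by split => [xy|/eqP//]; apply/eqP.
Qed.

Lemma lquot_pi_surj (q : lquot) : exists x, lquot_pi x = q.
Proof. by exists (repr (q : Quotient.quot (submod_pred X))); rewrite /lquot_pi reprK. Qed.

Lemma lquot_piD x y : lquot_pi (x + y) = lquot_pi x + lquot_pi y.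
Proof. exact: Quotient.pi_add. Qed.

Definition lquot_scale (k : K) (q : lquot) : lquot :=
  lquot_pi (k *: repr (q : Quotient.quot (submod_pred X))).

Lemma lquot_scale_pi k x : lquot_scale k (lquot_pi x) = lquot_pi (k *: x).
Proof.
apply/lquot_piE; rewrite -scalerBr rpredZ//.
by apply/lquot_piE; rewrite /lquot_pi reprK.
Qed.

Lemma lquot_scaleA a b q :
  lquot_scale a (lquot_scale b q) = lquot_scale (a * b) q.
Proof.
by have [x <-] := lquot_pi_surj q; rewrite !lquot_scale_pi scalerA.
Qed.

Lemma lquot_scale1 : left_id 1 lquot_scale.
Proof.
by move=> q; have [x <-] := lquot_pi_surj q; rewrite lquot_scale_pi scale1r.
Qed.

Lemma lquot_scaleDr : right_distributive lquot_scale +%R.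
Proof.
move=> k p q; have [x <-] := lquot_pi_surj p; have [y <-] := lquot_pi_surj q.
by rewrite -lquot_piD !lquot_scale_pi scalerDr lquot_piD.
Qed.

Lemma lquot_scaleDl q : {morph lquot_scale^~ q : a b / a + b}.
Proof.
move=> a b; have [x <-] := lquot_pi_surj q.
by rewrite !lquot_scale_pi scalerDl lquot_piD.
Qed.

HB.instance Definition _ := GRing.Zmodule_isLmodule.Build K lquot
  lquot_scaleA lquot_scale1 lquot_scaleDr lquot_scaleDl.

Lemma lquot_pi_is_linear : linear lquot_pi.
Proof. by move=> k x y; rewrite lquot_piD -lquot_scale_pi. Qed.

HB.instance Definition _ := GRing.isLinear.Build K E lquot *:%R lquot_pi
  lquot_pi_is_linear.

End AlgebraicQuotient.

Definition infinite_dimensional (K : nzRingType) (V : lmodType K) : Prop :=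
  ~ exists (n : nat) (v : 'I_n -> V),
      forall x, exists c : 'I_n -> K, x = \sum_(i < n) c i *: v i.

Definition infinite_codim (K : nzRingType) (E : lmodType K)
    (A : submodClosed E) : Prop :=
  infinite_dimensional (lquot A).

Definition separable (T : topologicalType) : Prop :=
  exists2 D : set T, countable D & dense D.

Section NormedQuotient.
Context (K : realType) (E : normedModType K) (X : closedSubspaceType E).

(* [lquot] is the purely algebraic quotient; [nquot] carries the quotient norm,
   which is definite because X is closed. *)
Definition nquot := lquot X.

HB.instance Definition _ := GRing.Lmodule.on nquot.

Definition nquot_pi (x : E) : nquot := lquot_pi X x.

Lemma nquot_pi_is_linear : linear nquot_pi.
Proof. exact: lquot_pi_is_linear. Qed.

HB.instance Definition _ := GRing.isLinear.Build K E nquot *:%R nquot_pi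
  nquot_pi_is_linear.

Definition coset_norms (q : nquot) : set K :=
  [set `|x| | x in [set x | nquot_pi x = q]].

Definition quotient_norm (q : nquot) : K := inf (coset_norms q).

Lemma coset_norms_has_inf q : has_inf (coset_norms q).
Proof.
split; last by exists 0 => _ [x _ <-].
by have [x xq] := lquot_pi_surj q; exists `|x|, x.
Qed.

Lemma quotient_norm_ge0 q : 0 <= quotient_norm q.
Proof.
apply: lb_le_inf; first by have [] := coset_norms_has_inf q.
by move=> _ [x _ <-].
Qed.

Lemma quotient_norm_le x : quotient_norm (nquot_pi x) <= `|x|.
Proof. by apply: ge_inf; [have [] := coset_norms_has_inf (nquot_pi x)|exists x]. Qed.

Lemma quotient_norm_lt q (e : K) : 0 < e ->
  exists2 x, nquot_pi x = q & `|x| < quotient_norm q + e.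
Proof.
move=> e0; have [_ [x xq <-] xe] := inf_adherent e0 (coset_norms_has_inf q).
by exists x.
Qed.

Lemma quotient_normD p q :
  quotient_norm (p + q) <= quotient_norm p + quotient_norm q.
Proof.
apply/ler_addgt0Pr => e e0.
have e20 : 0 < e / 2 by rewrite divr_gt0.
have [x xp xe] := quotient_norm_lt p e20.
have [y yq ye] := quotient_norm_lt q e20.
rewrite -xp -yq -(linearD nquot_pi).
rewrite (le_trans (quotient_norm_le _))// (le_trans (ler_normD _ _))//.
by rewrite (splitr e) addrACA xp yq lerD// ltW.
Qed.

Lemma quotient_normZ_le k q :
  quotient_norm (k *: q) <= `|k| * quotient_norm q.
Proof.
have [->|k0] := eqVneq k 0.
  rewrite scale0r normr0 mul0r -(linear0 nquot_pi).
  by rewrite (le_trans (quotient_norm_le _))// normr0.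
apply/ler_addgt0Pr => e e0.
have nk0 : 0 < `|k| by rewrite normr_gt0.
have [x xq xe] := quotient_norm_lt q (divr_gt0 e0 nk0).
rewrite -[in X in X <= _]xq -(linearZ_LR nquot_pi).
rewrite (le_trans (quotient_norm_le _))// normrZ.
rewrite -[e](mulfVK (lt0r_neq0 nk0)) [_ / _ * _]mulrC -mulrDr.
by rewrite ler_pM2l// ltW.
Qed.

Lemma quotient_normZ k q : quotient_norm (k *: q) = `|k| * quotient_norm q.
Proof.
apply/eqP; rewrite eq_le quotient_normZ_le/=.
have [->|k0] := eqVneq k 0; first by rewrite normr0 mul0r quotient_norm_ge0.
rewrite -[in X in X <= _](scale1r q) -(mulVf k0) -scalerA.
rewrite -ler_pdivlMl ?normr_gt0// -normfV.
exact: quotient_normZ_le.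
Qed.

Lemma quotient_norm_eq0 q : quotient_norm q = 0 -> q = 0.
Proof.
have [x <-] := lquot_pi_surj q => nx0.
rewrite -(linear0 nquot_pi); apply/lquot_piE; rewrite subr0.
suff : [set` X] x by [].
apply: (closed_pred_subproof (s := X)) => B /nbhs_ballP[e /= e0 xeB].
have [y yx] := quotient_norm_lt (nquot_pi x) e0.
rewrite [quotient_norm _]nx0 add0r => ye.
exists (x - y); split; first by apply/lquot_piE/esym.
by apply: xeB; rewrite -ball_normE /ball_/= opprB addrC subrK.
Qed.

HB.instance Definition _ := Lmodule_isNormed.Build K nquot
  quotient_normD quotient_normZ quotient_norm_eq0.

Lemma nquot_normE (q : nquot) : `|q| = quotient_norm q.
Proof. by []. Qed.

End NormedQuotient.

Definition has_separable_quotient (K : realType)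
    (E : completeNormedModType K) : Prop :=
  exists N : closedSubspaceType E,
    infinite_dimensional (nquot N) /\ separable (nquot N).

Definition bounded_operator (K : realType) (E F : normedModType K)
    (T : E -> F) : Prop :=
  exists M : K, forall x, `|T x| <= M * `|x|.

Definition operator_range (K : realType) (E : completeNormedModType K)
    (R : submodClosed E) : Prop :=
  exists (G : completeNormedModType K) (A : {linear G -> E}),
    bounded_operator A /\ range A = [set` R].

Definition proper_dense_operator_range (K : realType)
    (E : completeNormedModType K) (R : submodClosed E) : Prop :=
  [/\ operator_range R, dense [set` R] & [set` R] <> setT].

Section Duality.
Context (K : realType).

(* The dual space is represented as the set of bounded linear functionals
   inside the module of all functions E -> K, whose 0 is the zero functional. *)
Definition dual (E : normedModType K) : set (E -> K) :=
  [set f | scalar f /\ bounded_operator (f : E -> K^o)].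

Definition adjoint (E F : normedModType K) (T : E -> F) (g : F -> K) : E -> K :=
  g \o T.

Definition annihilator (E : normedModType K) (X : set E) : set (E -> K) :=
  [set f | dual f /\ forall x, X x -> f x = 0].

Lemma adjoint_dual (E F : normedModType K) (T : {linear E -> F}) (g : F -> K) :
  bounded_operator T -> dual g -> dual (adjoint T g).
Proof.
move=> [M hM] [glin [N hN]]; split=> [k x y|].
  by rewrite /adjoint/= linearP glin.
exists (`|N| * M) => x; rewrite /adjoint/=.
rewrite (le_trans (hN _))// (le_trans (ler_wpM2r _ (ler_norm N)))//.
by rewrite -mulrA ler_wpM2l.
Qed.

End Duality.

(* Main.v *)
Require Import Defs.
From HB Require Import structures.
From mathcomp Require Import all_boot all_order all_algebra.
From mathcomp Require Import all_classical all_reals all_analysis.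
From mathcomp Require Import ring lra.

Set Implicit Arguments.
Unset Strict Implicit.
Unset Printing Implicit Defensive.

Import Order.TTheory GRing.Theory Num.Theory.
Import numFieldNormedType.Exports.

Local Open Scope classical_set_scope.
Local Open Scope ring_scope.

(* Write R = A(G). Since R is proper and dense, A is not almost open, so by
   Hahn-Banach there are functionals of large norm that are small on A(ball).
   Together with almost-null vectors on which they take the value 1, they yield a
   biorthogonal system (x_n, f_n) with x_n rapidly decreasing and (f_n) pointwise
   bounded on R. Put X = bigcap ker f_n. Any sequence growing at most like 2^n is of
   the form f_n(y) with y = sum_n f_n(y) x_n, so E/X is spanned topologically by
   the x_n, and y's with f_n(y) unbounded on disjoint infinite sets of indices are
   independent modulo R + X.

   Condition (c) holds once every T x_k is a limit of points of T(X). For this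
   the f_n are moreover chosen so that T stays of dense range on
   V_n = ker f_0 /\ .. /\ ker f_(n-1): it suffices that f_n is not dominated by a
   multiple of |T| on V_n. Such functionals exist, since otherwise the uniform
   boundedness principle would make T bounded below on V_n, hence surjective. One
   then picks A u in V_(n+1) with T (A u) close to T x_k; the later f_j are bounded
   by 1 at A u, so a small correction along the later x_j moves A u into X. *)

(** * The Hahn-Banach theorem *)

Section HahnBanach.
Context (K : realType) (E : lmodType K) (p : E -> K).
Hypothesis pD : forall x y, p (x + y) <= p x + p y.
Hypothesis pZ : forall t x, 0 <= t -> p (t *: x) = t * p x.

(* Partial linear functionals are encoded by their graphs. *)
Let dominated_graph (G : set (E * K)) :=
  (forall a u v, G u -> G v -> G (a *: u.1 + v.1, a * u.2 + v.2)) /\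
  (forall u, G u -> u.2 <= p u.1).

Let graph_sub G a u v : dominated_graph G -> G u -> G v ->
  a * u.2 - v.2 <= p (a *: u.1 - v.1).
Proof.
move=> [Glin Gp] Gu Gv.
have G00 : G (0, 0).
  by have := Glin (-1) _ _ Gu Gu; rewrite scaleN1r mulN1r !addNr.
have /Gp/= := Glin (-1) _ _ Gv (Glin a _ _ Gu G00).
by rewrite /= !addr0 scaleN1r mulN1r ![- v.1 + _]addrC ![- v.2 + _]addrC.
Qed.

(** A value [c] at [x] is admissible when [u.2 - p (u.1 - x) <= c <= p (u.1 + x) - u.2] for all [u]
    in [G]. Subadditivity puts every lower bound below every upper one, so the supremum of the lower
    bounds works. *)
Let graph_extend G x : dominated_graph G -> (exists u, G u) ->
  exists2 G', dominated_graph G' & G `<=` G' /\ exists r, G' (x, r).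
Proof.
move=> GP [u0 Gu0]; have [Glin Gp] := GP.
pose S := [set u.2 - p (u.1 - x) | u in G].
have Sub v : G v -> forall s, S s -> s <= p (v.1 + x) - v.2.
  move=> Gv _ [u Gu <-].
  have uv : u.2 + v.2 <= p (u.1 + v.1).
    by have := Gp _ (Glin 1 _ _ Gu Gv); rewrite /= scale1r mul1r.
  have := pD (u.1 - x) (v.1 + x).
  rewrite addrACA addNr addr0 => h.
  by move: (le_trans uv h); lra.
have S0 : S !=set0 by exists (u0.2 - p (u0.1 - x)); exists u0.
have Ssup : has_sup S by split=> //; exists (p (u0.1 + x) - u0.2); exact: Sub.
pose c := sup S.
have c1 u : G u -> u.2 - p (u.1 - x) <= c.
  by move=> Gu; apply: ub_le_sup; [case: Ssup|exists u].
have c2 u : G u -> c <= p (u.1 + x) - u.2.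
  by move=> Gu; apply: ge_sup => //; exact: Sub.
have G00 : G (0, 0).
  by have := Glin (-1) _ _ Gu0 Gu0; rewrite scaleN1r mulN1r !addNr.
have GZ a u : G u -> G (a *: u.1, a * u.2).
  by move=> Gu; have := Glin a _ _ Gu G00; rewrite /= !addr0.
exists [set w | exists u t, G u /\ w = (u.1 + t *: x, u.2 + t * c)]; split.
- move=> a _ _ [u [s [Gu ->]]] [v [t [Gv ->]]] /=.
  exists (a *: u.1 + v.1, a * u.2 + v.2), (a * s + t); split; first exact: Glin.
  rewrite /= scalerDr scalerDl scalerA !addrA; congr (_, _).
    by rewrite -!addrA; congr (_ + _); rewrite addrCA.
  by ring.
- move=> _ [u [t [Gu ->]]] /=.
  (* Dividing by [|t|] reduces negative [t] to the lower bounds on [c] and positive [t] to the upper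
     ones. *)
  have [t0|t0|->] := ltgtP t 0; last by rewrite scale0r mul0r !addr0; exact: Gp.
    have s0 : 0 < - t by rewrite oppr_gt0.
    have := c1 _ (GZ (- t)^-1 _ Gu); rewrite /= => h.
    have : - t * ((- t)^-1 * u.2 - p ((- t)^-1 *: u.1 - x)) <= - t * c.
      by rewrite ler_pM2l.
    rewrite mulrBr mulrA divff ?gt_eqF// mul1r -(pZ _ (ltW s0)).
    rewrite scalerBr scalerA divff ?gt_eqF// scale1r scaleNr opprK.
    by lra.
  have := c2 _ (GZ t^-1 _ Gu); rewrite /= => h.
  have : t * c <= t * (p (t^-1 *: u.1 + x) - t^-1 * u.2) by rewrite ler_pM2l.
  rewrite mulrBr mulrA divff ?gt_eqF// mul1r -(pZ _ (ltW t0)).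
  rewrite scalerDr scalerA divff ?gt_eqF// scale1r.
  by lra.
- by move=> [u r] Gu; exists (u, r), 0; rewrite /= scale0r mul0r !addr0.
- by exists c, (0, 0), 1; rewrite /= scale1r mul1r !add0r.
Qed.

Lemma hahn_banach (x0 : E) :
  exists f : {scalar E}, f x0 = p x0 /\ forall x, f x <= p x.
Proof.
have p0 : p 0 = 0 by rewrite -[in LHS](scale0r (0 : E)) pZ// mul0r.
pose G0 := [set u : E * K | exists t, u = (t *: x0, t * p x0)].
have G0P : dominated_graph G0.
  split=> [a _ _ [s ->] [t ->]|_ [t ->]]/=.
    by exists (a * s + t); rewrite scalerDl scalerA mulrDl mulrA.
  have [t0|t0] := leP 0 t; first by rewrite pZ.
  have := pD (t *: x0) ((- t) *: x0).
  rewrite -scalerDl subrr scale0r p0 (pZ (t := - t)) ?oppr_ge0 ?(ltW t0)//.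
  by rewrite mulNr subr_ge0.
(* The empty graph is allowed, so that the union of an empty chain is. *)
have [|G [[GP GG0] Gmax]] := @Zorn_bigcup _
    [set G | dominated_graph G /\ ((exists u, G u) -> G0 `<=` G)].
  move=> C CP Ctot; split; last first.
    move=> [u [G CG Gu]]; have [_ G0G] := CP _ CG.
    by move=> v G0v; exists G => //; apply: G0G => //; exists u.
  split=> [a u v [G CG Gu] [H CH Hv]|u [G CG Gu]]; last first.
    by have [[_ +] _] := CP _ CG; exact.
  have [GH|HG] := Ctot _ _ CG CH.
    by exists H => //; have [[+ _] _] := CP _ CH; apply=> //; exact: GH.
  by exists G => //; have [[+ _] _] := CP _ CG; apply=> //; exact: HG.
have Gx0 : G (x0, p x0).
  have [/GG0|G_0] := pselect (exists u, G u).
    by apply; exists 1; rewrite scale1r mul1r.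
  exfalso; apply: (Gmax G0); last by split=> // _ u.
  split=> [u Gu|GG]; first by exfalso; apply: G_0; exists u.
  by apply: G_0; exists (x0, p x0); apply: GG; exists 1; rewrite scale1r mul1r.
have total x : exists r, G (x, r).
  have [//|xG] := pselect (exists r, G (x, r)).
  have Gne : exists u, G u by exists (x0, p x0).
  have [G' G'P [GG' xG']] := graph_extend x GP Gne.
  exfalso; apply: (Gmax G').
    by split=> // G'G; apply: xG; case: xG' => r /G'G; exists r.
  split=> // _ u G0u; apply: GG'; exact: GG0.
(* The difference of two values over the same point is at most [p 0 = 0]. *)
have functional x r s : G (x, r) -> G (x, s) -> r <= s.
  move=> Gr Gs; have := graph_sub 1 GP Gr Gs.
  by rewrite scale1r mul1r/= subrr p0 subr_le0.
have [f Gf] := choice total.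
have flin : scalar f.
  move=> a u v; have := GP.1 a _ _ (Gf u) (Gf v) => /= h.
  by apply: le_anti; rewrite !(functional (a *: u + v)).
exists (HB.pack f (GRing.isLinear.Build _ _ _ _ f flin) : {scalar E}) => /=.
split=> [|x]; last exact: (GP.2 _ (Gf x)).
by apply: le_anti; rewrite !(functional x0).
Qed.

End HahnBanach.

Lemma hahn_banach_seminorm (K : realType) (E : lmodType K) (p : E -> K) (x0 : E) :
    (forall x y, p (x + y) <= p x + p y) ->
    (forall t x, p (t *: x) = `|t| * p x) ->
  exists f : {scalar E}, f x0 = p x0 /\ forall x, `|f x| <= p x.
Proof.
move=> pD pZ; have [t x t0|f [fx0 fp]] := @hahn_banach K E p pD _ x0.
  by rewrite pZ ger0_norm.
exists f; split=> // x; rewrite ler_norml fp andbT.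
by have := fp (- x); rewrite linearN -scaleN1r pZ normrN1 mul1r lerNl.
Qed.

(** * Limiting arguments and geometric convergence *)

Lemma le_all_gt0 (K : realType) (a b c : K) :
  (forall e, 0 < e -> a <= b + c * e) -> a <= b.
Proof.
move=> h; apply/ler_addgt0Pr => e e0.
have d0 : 0 < e / (1 + `|c|) by rewrite divr_gt0// ltr_pwDl.
apply: (le_trans (h _ d0)); rewrite lerD2l.
apply: (le_trans (y := (1 + `|c|) * (e / (1 + `|c|)))).
  by apply: ler_wpM2r; [exact: ltW|rewrite (le_trans (ler_norm c))// lerDr].
by rewrite mulrCA divff ?mulr1// gt_eqF// ltr_pwDl.
Qed.

Section Geometric.
Context (K : realType).

Lemma expr_half_small (q e : K) : 0 <= q -> q <= 2^-1 -> 0 < e ->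
  exists n, q ^+ n < e.
Proof.
move=> q0 q1 e0.
have q2 : `|q| < 1 by rewrite ger0_norm//; lra.
have /cvgr0Pnorm_lt/(_ _ e0)[N _ /(_ N (leqnn N))/= h] := cvg_expr q2.
by exists N; rewrite (le_lt_trans (ler_norm _)).
Qed.

Lemma le_expr_half (q a b c : K) : 0 <= q -> q <= 2^-1 ->
  (forall n, a <= b + c * q ^+ n) -> a <= b.
Proof.
move=> q0 q1 h; apply: (@le_all_gt0 _ _ _ `|c|) => e e0.
have [n qe] := expr_half_small q0 q1 e0.
rewrite (le_trans (h n))// lerD2l (le_trans (ler_norm _))// normrM.
by rewrite ler_wpM2l// ger0_norm ?exprn_ge0// ltW.
Qed.

Lemma geometric_dist (V : normedModType K) (s : nat -> V) (C q : K) :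
    0 <= q -> q <= 2^-1 ->
    (forall n, `|s n.+1 - s n| <= C * q ^+ n) ->
  forall n m, (n <= m)%N -> `|s m - s n| <= 2 * C * q ^+ n.
Proof.
move=> q0 q1 hs n m nm.
have C0 : 0 <= C by have := hs 0; rewrite expr0 mulr1; apply: le_trans.
rewrite -(subnKC nm); move: (m - n)%N => {nm m} k.
(* A telescoping bound is proved instead: [q <= 1/2] gives [q^m <= 2 (q^m - q^(m+1))]. *)
suff : `|s (n + k)%N - s n| <= 2 * C * (q ^+ n - q ^+ (n + k)).
  move=> h; apply: (le_trans h); rewrite ler_wpM2l ?mulr_ge0//.
  by rewrite gerBl exprn_ge0.
elim: k => [|k ih]; first by rewrite addn0 !subrr normr0 mulr0.
rewrite addnS (le_trans (ler_distD (s (n + k)%N) _ _))//.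
rewrite (le_trans (lerD (hs _) ih))// exprS.
have := exprn_ge0 (n + k) q0; set z := q ^+ (n + k) => z0.
have h : 0 <= C * (z * (1 - 2 * q)) by rewrite !mulr_ge0//; lra.
by lra.
Qed.

Lemma geometric_cauchy (V : completeNormedModType K) (s : nat -> V) (C q : K) :
    0 <= q -> q <= 2^-1 ->
    (forall n, `|s n.+1 - s n| <= C * q ^+ n) ->
  exists l, forall n, `|l - s n| <= 2 * C * q ^+ n.
Proof.
move=> q0 q1 hs; have sd := geometric_dist q0 q1 hs.
have C0 : 0 <= C by have := hs 0; rewrite expr0 mulr1; apply: le_trans.
have cs : cauchy (s @ \oo).
  apply: cauchy_exP => e e0.
  have C1 : 0 < 1 + 2 * C by rewrite ltr_pwDl// mulr_ge0.
  have [N Ne] := expr_half_small q0 q1 (divr_gt0 e0 C1).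
  exists (s N), N => // n /= Nn.
  rewrite -ball_normE /ball_/= distrC (le_lt_trans (sd _ _ Nn))//.
  move: Ne; rewrite ltr_pdivlMr ?ltr_pwDl ?mulr_ge0// mulrC mulrDl mul1r.
  by apply: le_lt_trans; rewrite lerDr exprn_ge0.
have cv : cvg (s @ \oo) by exact: cauchy_cvg.
exists (lim (s @ \oo)) => n; apply/ler_addgt0Pr => e e0.
have /cvgr_dist_lt/(_ _ e0)[N _ hN] := cv.
apply: (le_trans (ler_distD (s (maxn n N)) _ _)); rewrite [leRHS]addrC lerD//.
  by apply/ltW/hN => /=; rewrite leq_maxr.
by apply: sd; rewrite leq_maxl.
Qed.

End Geometric.

(** * Bounded functionals and the uniform boundedness principle *)

Lemma dual_scalar (K : realType) (E : normedModType K) (f : E -> K) : dual f ->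
  exists (g : {scalar E}) (M : K),
    [/\ 0 <= M, g = f :> (E -> K) & forall x, `|g x| <= M * `|x|].
Proof.
move=> [flin [M hM]].
exists (HB.pack f (GRing.isLinear.Build _ _ _ _ f flin) : {scalar E}), `|M|.
split=> [//|//|x]; apply: (le_trans (hM x)).
by rewrite ler_wpM2r// ler_norm.
Qed.

(* Gliding hump with signs: adding or subtracting [r g] makes the value at [u] at
   least [r |g u|], so the [n]-th term controls the value at [u_n] whatever the
   previous terms are. *)
Lemma weakly_bounded_bounded (K : realType) (E : normedModType K) (U : set E) :
    (forall f : E -> K, dual f -> exists C, forall x, U x -> `|f x| <= C) ->
  exists C, forall x, U x -> `|x| <= C.
Proof.
move=> Uw; apply: contrapT => Unb.
(* With ratio 1/4 the corrections after the [n]-th change the value at [u n] by at most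
   [2 * q^(n+1) * |u n|], half of the hump [q^n * |u n|]. The other half is at least [n], by the
   factor 2 in [big]. *)
pose q : K := 4^-1.
have q0 : 0 <= q by rewrite /q invr_ge0.
have q1 : q <= 2^-1 by rewrite /q lef_pV2 ?posrE//; lra.
have qn0 n : 0 < q ^+ n by rewrite exprn_gt0 ?invr_gt0.
have big n : exists u, U u /\ 2 * n%:R <= q ^+ n * `|u|.
  apply: contrapT => nu; apply: Unb; exists (q ^- n * (2 * n%:R)) => x Ux.
  rewrite leNgt; apply/negP => h; apply: nu; exists x; split=> //.
  by rewrite ltW// -ltr_pdivrMl.
have [u hu] := choice big.
have norming n : exists g : {scalar E}, g (u n) = `|u n| /\ forall x, `|g x| <= `|x|.
  by apply: hahn_banach_seminorm; [exact: ler_normD|exact: normrZ].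
have [g hg] := choice norming.
have step (n : nat) (h : {scalar E}) : exists h' : {scalar E},
    (forall x, `|h' x - h x| <= `|x| * q ^+ n) /\ q ^+ n * `|u n| <= `|h' (u n)|.
  have [gu gx] := hg n.
  have mk (a : K) : exists h' : {scalar E}, forall x, h' x = h x + a * g n x.
    have lin : scalar (fun x => h x + a * g n x).
      by move=> b x y; rewrite !scalarP; ring.
    by exists (HB.pack (fun x => h x + a * g n x)
      (GRing.isLinear.Build _ _ _ _ (fun x => h x + a * g n x) lin) : {scalar E}).
  have qu : 0 <= q ^+ n * `|u n| by rewrite mulr_ge0// ltW.
  have [h0|h0] := leP 0 (h (u n)).
    have [h' h'E] := mk (q ^+ n); exists h'; split=> [x|].
      by rewrite h'E addrC addKr normrM mulrC (gtr0_norm (qn0 n)) ler_pM2r.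
    by rewrite h'E gu (le_trans _ (ler_norm _))//; lra.
  have [h' h'E] := mk (- q ^+ n); exists h'; split=> [x|].
    by rewrite h'E addrC addKr normrM mulrC normrN (gtr0_norm (qn0 n)) ler_pM2r.
  by rewrite h'E gu ler_normr; apply/orP; right; lra.
have [nxt hnxt] := choice (fun nh : nat * {scalar E} => step nh.1 nh.2).
pose fix s n : {scalar E} := if n is m.+1 then nxt (m, s m) else \0.
have sS n x : `|s n.+1 x - s n x| <= `|x| * q ^+ n := (hnxt (n, s n)).1 x.
have su n : q ^+ n * `|u n| <= `|s n.+1 (u n)| := (hnxt (n, s n)).2.
have lim x : exists l : K, forall n, `|l - s n x| <= 2 * `|x| * q ^+ n.
  exact: (@geometric_cauchy K K^o (fun n => s n x) _ _ q0 q1 (sS ^~ x)).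
have [f hf] := choice lim.
have flin : scalar f.
  move=> a x y; apply/eqP; rewrite -subr_eq0 -normr_le0.
  apply: (@le_expr_half _ q _ _ (2 * `|a *: x + y| + `|a| * (2 * `|x|) + 2 * `|y|)) => // n.
  have -> : f (a *: x + y) - (a * f x + f y) =
      (f (a *: x + y) - s n (a *: x + y)) - a * (f x - s n x) - (f y - s n y).
    by rewrite scalarP; ring.
  rewrite add0r (mulrDl _ (2 * `|y|)) (mulrDl _ (`|a| * (2 * `|x|))).
  apply: (le_trans (ler_normB _ _)); rewrite lerD//.
  apply: (le_trans (ler_normB _ _)); rewrite lerD//.
  by rewrite normrM -mulrA ler_wpM2l.
have fdual : dual f.
  split=> //; exists 2 => x; have := hf x 0; rewrite expr0 mulr1 /=.
  by rewrite subr0.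
have [C hC] := Uw f fdual.
have [n Cn] : exists n : nat, C < n%:R.
  by exists (Num.truncn `|C|).+1; rewrite (le_lt_trans (ler_norm _))// truncnS_gt.
have [Uu un] := hu n; have := hC _ Uu; apply/negP; rewrite -ltNge.
apply: (lt_le_trans Cn); have := hf (u n) n.+1.
have : `|s n.+1 (u n)| <= `|f (u n)| + `|f (u n) - s n.+1 (u n)|.
  by rewrite addrC -lerBlDr (le_trans (lerB_dist _ _))// distrC.
have := su n; rewrite exprS /q; move: un; rewrite -/q.
set z := q ^+ n * `|u n|.
have -> : 2 * `|u n| * (4^-1 * q ^+ n) = z / 2 by rewrite /z; field.
lra.
Qed.

(** * Almost open operators are onto *)

Section AlmostOpen.
Context (K : realType) (G : completeNormedModType K) (E : normedModType K).
Context (B : {linear G -> E}) (M : K) (BM : forall u, `|B u| <= M * `|u|).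

(** Successive approximation as in the open mapping theorem: the residual [v - B w], which stays in
    [V], is rescaled to norm at most [d] and halved by a geometrically small change of [w].
    Completeness of [G] yields the preimage. *)
Lemma almost_open_surjective (V : set E) (d c : K) :
    (forall a x y, V x -> V y -> V (a *: x + y)) ->
    (forall u, V (B u)) -> 0 < d ->
    (forall v, V v -> `|v| <= d -> forall e, 0 < e ->
      exists u, `|u| <= c /\ `|v - B u| < e) ->
  forall v, V v -> exists u, B u = v.
Proof.
move=> Vlin BV d0 dense_ball v vV.
have [->|v0] := eqVneq v 0; first by exists 0; rewrite linear0.
have {}v0 : 0 < `|v| by rewrite normr_gt0.
pose q : K := 2^-1.
have q0 : 0 <= q by rewrite /q invr_ge0.
have qn0 n : 0 < q ^+ n by rewrite exprn_gt0 ?invr_gt0.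
pose near_v n w := `|v - B w| <= `|v| * q ^+ n.
have improve (n : nat) (w : G) : exists w', near_v n w ->
    near_v n.+1 w' /\ `|w' - w| <= c * (`|v| / d) * q ^+ n.
  have [vw|//] := pselect (near_v n w); last by exists w.
  pose t := `|v| * q ^+ n.
  have t0 : 0 < t by rewrite mulr_gt0.
  have td0 : 0 < t / d by rewrite divr_gt0.
  have xV : V ((t / d)^-1 *: (v - B w)).
    have := Vlin (t / d)^-1 _ _ (Vlin (-1) _ _ (BV w) vV) (Vlin (-1) _ _ vV vV).
    by rewrite !scaleN1r addNr addr0 [- B w + v]addrC.
  have xd : `|(t / d)^-1 *: (v - B w)| <= d.
    by rewrite normrZ gtr0_norm ?invr_gt0// ler_pdivrMl// divfK ?gt_eqF.
  (* Precision [d / 2] on the rescaled residual halves the original one. *)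
  have [u [uc ue]] := dense_ball _ xV xd _ (divr_gt0 d0 (ltr0Sn K 1)).
  exists (w + (t / d) *: u) => _; split; last first.
    rewrite addrC addKr normrZ gtr0_norm// [leRHS](_ : _ = t / d * c).
      by rewrite ler_pM2l.
    by rewrite /t; field; rewrite gt_eqF.
  rewrite /near_v.
  have -> : v - B (w + (t / d) *: u) = (t / d) *: ((t / d)^-1 *: (v - B w) - B u).
    by rewrite scalerBr scalerA divff ?gt_eqF// scale1r linearD linearZ/= opprD addrA.
  rewrite normrZ gtr0_norm// exprS mulrCA -/t.
  apply: (le_trans (ler_wpM2l (ltW td0) (ltW ue))).
  by rewrite /q le_eqVlt; apply/orP; left; apply/eqP; field; rewrite gt_eqF.
have [nxt hnxt] := choice (fun nw : nat * G => improve nw.1 nw.2).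
pose fix s n : G := if n is m.+1 then nxt (m, s m) else 0.
have sv n : near_v n (s n).
  elim: n => [|n ih]; first by rewrite /near_v linear0 subr0 expr0 mulr1.
  by have [] := hnxt (n, s n) ih.
have sS n : `|s n.+1 - s n| <= c * (`|v| / d) * q ^+ n.
  by have [] := hnxt (n, s n) (sv n).
have [l hl] := geometric_cauchy q0 (lexx _) sS.
exists l; apply/eqP; rewrite eq_sym -subr_eq0 -normr_le0.
apply: (@le_expr_half _ q _ _ (`|v| + `|M| * (2 * (c * (`|v| / d))))) => // n.
have -> : v - B l = (v - B (s n)) - B (l - s n) by rewrite linearB opprB addrA subrK.
rewrite add0r mulrDl; apply: (le_trans (ler_normB _ _)); rewrite lerD//; first exact: sv.
apply: (le_trans (BM _)); apply: (le_trans (ler_wpM2r _ (ler_norm M))) => //.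
by rewrite -mulrA ler_wpM2l.
Qed.

End AlmostOpen.

Lemma bounded_operator_gt0 (K : realType) (E F : normedModType K) (T : E -> F) :
  bounded_operator T -> exists2 M, 0 < M & forall x, `|T x| <= M * `|x|.
Proof.
move=> [M TM]; exists (1 + `|M|) => [|x]; first by rewrite ltr_pwDl.
by apply: (le_trans (TM x)); rewrite ler_wpM2r// (le_trans (ler_norm M))// lerDr.
Qed.

(** * Functionals not dominated by an operator of dense range *)

Section DenseRange.
Context (K : realType) (E : completeNormedModType K) (F : normedModType K).
Context (T : {linear E -> F}) (V : set E).
Hypothesis T_bounded : bounded_operator T.
Hypothesis Vlin : forall a x y, V x -> V y -> V (a *: x + y).
Hypothesis TV_dense : forall w e, 0 < e -> exists x, V x /\ `|w - T x| < e.

(** Approximate preimages of [w] taken in [V] form a Cauchy sequence by the lower bound; the limit,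
    possibly outside [V], is a preimage. *)
Lemma bounded_below_surjective (C : K) :
  (forall x, V x -> `|x| <= C * `|T x|) -> forall w, exists x, T x = w.
Proof.
move=> TC w; have [M M0 TM] := bounded_operator_gt0 T_bounded.
pose q : K := 2^-1.
have q0 : 0 < q by rewrite /q invr_gt0.
have [s hs] := choice (fun n : nat => TV_dense w (exprn_gt0 n q0)).
have sS n : `|s n.+1 - s n| <= (`|C| * 2) * q ^+ n.
  have VS : V (s n.+1 - s n).
    by rewrite addrC -scaleN1r; apply: Vlin; [exact: (hs n).1|exact: (hs n.+1).1].
  apply: (le_trans (TC _ VS)); apply: (le_trans (ler_wpM2r _ (ler_norm C))) => //.
  rewrite -mulrA ler_wpM2l// linearB.
  have := (hs n).2; have := (hs n.+1).2; rewrite exprS => h1 h2.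
  apply: (le_trans (ler_distD w _ _)); rewrite distrC.
  by have : q * q ^+ n <= q ^+ n; [rewrite ler_piMl ?exprn_ge0 ?ltW// /q; lra|lra].
have [l hl] := geometric_cauchy (ltW q0) (lexx _) sS.
exists l; apply/eqP; rewrite eq_sym -subr_eq0 -normr_le0.
apply: (@le_expr_half _ q _ _ (1 + M * (2 * (`|C| * 2)))) => [|//|n]; first exact: ltW.
have -> : w - T l = (w - T (s n)) - T (l - s n) by rewrite linearB opprB addrA subrK.
rewrite add0r mulrDl mul1r; apply: (le_trans (ler_normB _ _)).
rewrite lerD ?(ltW (hs n).2)//; apply: (le_trans (TM _)).
by rewrite -mulrA ler_pM2l.
Qed.

(** If every bounded functional were dominated on [V] by a multiple of [|T|], the set of [x] in [V]
    with [|T x| <= 1] would be weakly bounded, hence bounded, and [T] would be bounded below on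
    [V]. *)
Lemma exists_undominated_functional :
    (exists w, forall x, T x <> w) ->
  exists f : E -> K, dual f /\ forall C, exists x, V x /\ C * `|T x| < `|f x|.
Proof.
move=> [w Tw]; apply: contrapT => dom.
have V0 : V 0.
  by have [x [Vx _]] := TV_dense 0 (@ltr01 K); have := Vlin (-1) Vx Vx; rewrite scaleN1r addNr.
have VZ a x : V x -> V (a *: x) by move=> Vx; have := Vlin a Vx V0; rewrite addr0.
have [|C UC] := @weakly_bounded_bounded _ E [set x | V x /\ `|T x| <= 1].
  move=> f fdual; apply: contrapT => funb; apply: dom; exists f; split=> // C.
  apply: contrapT => fC; apply: funb; exists `|C| => x [Vx Tx].
  rewrite leNgt; apply/negP => xC; apply: fC; exists x; split=> //.
  apply: le_lt_trans xC; apply: (le_trans (ler_wpM2r _ (ler_norm C))) => //.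
  by rewrite ler_piMr.
suff /bounded_below_surjective/(_ w)[x] : forall x, V x -> `|x| <= C * `|T x|.
  exact: Tw.
(* Normalizing by [|T x| + e] covers the case [T x = 0]. *)
move=> x Vx; apply: (@le_all_gt0 _ _ _ C) => e e0.
have d0 : 0 < `|T x| + e by rewrite ltr_wpDl.
have /= := UC ((`|T x| + e)^-1 *: x); rewrite linearZ/= !normrZ gtr0_norm ?invr_gt0//.
rewrite !ler_pdivrMl// mulr1 mulrC -mulrDr; apply; split; first exact: VZ.
by rewrite lerDl ltW.
Qed.

End DenseRange.

(** * Functionals small on a proper operator range *)

Section SmallOnRange.
Context (K : realType) (G : completeNormedModType K) (E : normedModType K).
Context (B : {linear G -> E}) (B_bounded : bounded_operator B).

(* [p] below is the largest seminorm with [p z <= L |z|] and [p (B u) <= e |u|]. *)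
Lemma exists_functional_small_on_range (V : set E) (e d : K) :
    (forall a x y, V x -> V y -> V (a *: x + y)) ->
    (forall u, V (B u)) -> (exists v, V v /\ forall u, B u <> v) ->
    0 < e -> 0 < d ->
  exists g : {scalar E}, bounded_operator (g : E -> K^o) /\
    (forall u, `|g (B u)| <= e * `|u|) /\
    exists y, [/\ V y, `|y| <= d & 1 <= g y].
Proof.
move=> Vlin BV [v [Vv Bv]] e0 d0; have [M M0 BM] := bounded_operator_gt0 B_bounded.
(* Since [B] does not cover [V], it is not almost open with constant [1/e]: some small [y] keeps a
   distance [r] from the image of the ball of radius [1/e]. *)
have [y [r [Vy yd r0 hy]]] : exists y r, [/\ V y, `|y| <= d, 0 < r &
    forall u, `|u| <= e^-1 -> r <= `|y - B u|].
  apply: contrapT => no.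
  have [//|//|//||//|u /Bv//] := @almost_open_surjective _ _ _ B M BM V d e^-1 _ _ _ _ v.
  move=> y Vy yd r r0; apply: contrapT => nu; apply: no; exists y, r; split=> // u ue.
  by rewrite leNgt; apply/negP => ur; apply: nu; exists u.
(* This [L] makes [p y >= 1]: the term [L * |y - B u|] is at least 1 when [|u| <= 1/e], and
   [e * |u|] is otherwise. *)
pose L := r^-1; have L0 : 0 < L by rewrite invr_gt0.
pose val (z : E) (u : G) := e * `|u| + L * `|z - B u|.
have val0 z u : 0 <= val z u by rewrite addr_ge0// mulr_ge0// ltW.
pose p z := inf [set val z u | u in setT].
have pinf z : has_inf [set val z u | u in setT].
  by split; [exists (val z 0); exists 0|exists 0 => _ [u _ <-]].
have p_le z u : p z <= val z u.
  by apply: ge_inf; [case: (pinf z)|exists u].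
have p_ge z a : (forall u, a <= val z u) -> a <= p z.
  by move=> h; apply: lb_le_inf; [case: (pinf z)|move=> _ [u _ <-]].
have p_lt z s : 0 < s -> exists u, val z u < p z + s.
  by move=> s0; have [_ [u _ <-] us] := inf_adherent s0 (pinf z); exists u.
have pD x z : p (x + z) <= p x + p z.
  apply: (@le_all_gt0 _ _ _ 2) => s s0.
  have [u us] := p_lt x s s0; have [t ts] := p_lt z s s0.
  apply: (le_trans (p_le _ (u + t))); apply: (le_trans (y := val x u + val z t)).
    rewrite /val linearD opprD addrACA [leRHS]addrACA -!mulrDr.
    by apply: lerD; rewrite ler_pM2l// ler_normD.
  by move: us ts; lra.
have pZ_le t z : p (t *: z) <= `|t| * p z.
  apply: (@le_all_gt0 _ _ _ `|t|) => s s0; have [u us] := p_lt z s s0.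
  apply: (le_trans (p_le _ (t *: u))); rewrite -mulrDr.
  apply: (le_trans (y := `|t| * val z u)); last by rewrite ler_wpM2l// ltW.
  rewrite /val linearZ/= -scalerBr !normrZ le_eqVlt; apply/orP; left; apply/eqP.
  by ring.
have pZ t z : p (t *: z) = `|t| * p z.
  apply/eqP; rewrite eq_le pZ_le/=; have [->|t0] := eqVneq t 0.
    by rewrite normr0 mul0r; apply: p_ge.
  have := pZ_le t^-1 (t *: z); rewrite scalerA mulVf// scale1r normfV.
  by rewrite ler_pdivlMl// normr_gt0.
have [g [gy gp]] := hahn_banach_seminorm y pD pZ.
exists g; split; [exists L => z|split=> [u|]].
- apply: (le_trans (gp z)); apply: (le_trans (p_le z 0)).
  by rewrite /val normr0 mulr0 add0r linear0 subr0.
- apply: (le_trans (gp _)); apply: (le_trans (p_le _ u)).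
  by rewrite /val subrr normr0 mulr0 addr0.
- exists y; split=> //; rewrite gy; apply: p_ge => u.
  have [ue|ue] := leP `|u| e^-1.
    rewrite -[1](mulVf (lt0r_neq0 r0)); apply: (le_trans (y := L * `|y - B u|)).
      by rewrite ler_pM2l// hy.
    by rewrite lerDr mulr_ge0// ltW.
  rewrite -[1](mulfV (lt0r_neq0 e0)); apply: (le_trans (y := e * `|u|)).
    by rewrite ler_pM2l// ltW.
  by rewrite lerDl mulr_ge0// ltW.
Qed.

End SmallOnRange.

(** * One step of the construction *)

Section Step.
Context (K : realType) (E F G : completeNormedModType K).
Context (T : {linear E -> F}) (A : {linear G -> E}).
Hypothesis T_bounded : bounded_operator T.
Hypothesis A_bounded : bounded_operator A.
Hypothesis A_dense : forall x e, 0 < e -> exists u, `|x - A u| < e.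
Hypothesis A_proper : exists x, forall u, A u <> x.
Hypothesis T_proper : exists w, forall x, T x <> w.
Context (N : nat) (f : nat -> {scalar E}) (x : nat -> E).

Definition vanish (n : nat) (z : E) := forall i, (i < n)%N -> f i z = 0.

(** The approximating points are taken in the range of [A], because the later functionals are
    controlled there by the norm of [u]. *)
Definition dense_on_vanish (n : nat) := forall w e, 0 < e ->
  exists u, vanish n (A u) /\ `|w - T (A u)| < e.

Hypothesis f_bounded : forall i, (i < N)%N -> bounded_operator (f i : E -> K^o).
Hypothesis biorthogonal :
  forall i j, (i < N)%N -> (j < N)%N -> f i (x j) = (i == j)%:R.
Hypothesis x_range : forall i, (i < N)%N -> exists u, A u = x i.
Hypothesis T_dense : dense_on_vanish N.

(** Subtracting [sum_i f_i(z) x_i] projects onto the common kernel along the span of the [x i]. As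
    these lie in the range of [A], the projection maps that range into itself. *)
Let exists_projection : exists Q : {linear E -> E},
  [/\ bounded_operator Q, forall z, vanish N (Q z), forall z, vanish N z -> Q z = z,
      forall i, (i < N)%N -> Q (x i) = 0 & forall z, exists u, z - Q z = A u].
Proof.
pose proj (z : E) : E := z - \sum_(i < N) f i z *: x i.
have proj_linear : linear proj.
  move=> a y z; rewrite /proj scalerBr scaler_sumr.
  rewrite addrACA -opprD -big_split/=; congr (_ - _); apply: eq_bigr => i _.
  by rewrite scalarP scalerDl scalerA.
exists (HB.pack proj (GRing.isLinear.Build _ _ _ _ proj proj_linear) : {linear E -> E}).
rewrite /= /proj; split.
- have /choice[M hM] : forall i : 'I_N, exists m, forall z, `|f i z| <= m * `|z|.
    by move=> i; have [m hm] := f_bounded (ltn_ord i); exists m.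
  exists (1 + \sum_(i < N) M i * `|x i|) => z; rewrite mulrDl mul1r.
  apply: (le_trans (ler_normB _ _)); rewrite lerD2l.
  apply: (le_trans (ler_norm_sum _ _ _)); rewrite mulr_suml; apply: ler_sum => i _.
  by rewrite normrZ mulrAC ler_wpM2r.
- move=> z j jN; rewrite linearB linear_sum/=.
  rewrite (bigD1 (Ordinal jN))//= linearZ_LR/= biorthogonal// eqxx mulr1.
  rewrite big1 ?addr0 ?subrr// => i ij; rewrite linearZ_LR/= biorthogonal//.
  by rewrite (_ : (j == i) = false) ?mulr0//; apply/negbTE; rewrite eq_sym; exact: ij.
- by move=> z Vz; rewrite big1 ?subr0// => i _; rewrite Vz// scale0r.
- move=> i iN; rewrite (bigD1 (Ordinal iN))//= biorthogonal// eqxx scale1r.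
  rewrite big1 ?addr0 ?subrr// => j ji; rewrite biorthogonal//.
  by rewrite (_ : (j == i :> nat) = false) ?scale0r//; apply/negbTE; exact: ji.
- move=> z; suff [u uE] : exists u, \sum_(i < N) f i z *: x i = A u.
    by exists u; rewrite uE subKr.
  elim/big_ind: _ => [|_ _ [u ->] [v ->]|i _]; first by exists 0; rewrite linear0.
    by exists (u + v); rewrite linearD.
  by have [u ux] := x_range (ltn_ord i); exists (f i z *: u); rewrite linearZ/= ux.
Qed.

Let Q : {linear E -> E} := projT1 (cid exists_projection).

Let Q_bounded : bounded_operator Q.
Proof. by have [] := projT2 (cid exists_projection). Qed.

Let Q_vanish z : vanish N (Q z).
Proof. by have [_ + _ _ _] := projT2 (cid exists_projection). Qed.

Let Q_id z : vanish N z -> Q z = z.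
Proof. by have [_ _ + _ _] := projT2 (cid exists_projection); exact. Qed.

Let Q_x i : (i < N)%N -> Q (x i) = 0.
Proof. by have [_ _ _ + _] := projT2 (cid exists_projection); exact. Qed.

Let Q_range z : exists u, z - Q z = A u.
Proof. by have [_ _ _ _ +] := projT2 (cid exists_projection); exact. Qed.

Let vanish_linear a y z : vanish N y -> vanish N z -> vanish N (a *: y + z).
Proof. by move=> Vy Vz i iN; rewrite scalarP Vy// Vz// mulr0 addr0. Qed.

Let VR := [set z | vanish N z /\ exists u, A u = z].

Definition undominated (g : E -> K) := forall C, exists z, VR z /\ C * `|T z| < `|g z|.

Let exists_undominated : exists g : {scalar E},
  bounded_operator (g : E -> K^o) /\ undominated g.
Proof.
have [|||g [gdual gund]] := @exists_undominated_functional _ _ _ T VR T_bounded.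
- move=> a y z [Vy [u uy]] [Vz [v vz]]; split; first exact: vanish_linear.
  by exists (a *: u + v); rewrite linearP uy vz.
- move=> w e e0; have [u [Vu uw]] := T_dense w e0.
  by exists (A u); split=> //; split=> //; exists u.
- exact: T_proper.
have [h [M [_ hg hM]]] := dual_scalar gdual.
by exists h; split; [exists M|rewrite hg].
Qed.

Let combine (g h : {scalar E}) (a : K) :
  exists k : {scalar E}, forall z, k z = g z + a * h z.
Proof.
have lin : scalar (fun z => g z + a * h z) by move=> b y z; rewrite !scalarP; ring.
by exists (HB.pack (fun z => g z + a * h z)
  (GRing.isLinear.Build _ _ _ _ (fun z => g z + a * h z) lin) : {scalar E}).
Qed.

(** [Q] moves points only by elements of the range of [A], so if [z] is outside this range, [Q z] is
    outside the range of [Q \o A]. *)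
Let QA_proper : exists v, vanish N v /\ forall u, Q (A u) <> v.
Proof.
have [z Az] := A_proper; exists (Q z); split=> [|u QuQz]; first exact: Q_vanish.
have [s zs] := Q_range z; have [t ut] := Q_range (A u).
apply: (Az (s + (u - t))); rewrite linearD linearB -zs -ut QuQz.
by rewrite [A u - (A u - Q z)]subKr subrK.
Qed.

(** If the functional [g] small on the range happens to be dominated by [|T|], a small multiple of
    an undominated [h] is added; the sum is undominated and still small. *)
Let exists_small_undominated (e d : K) : 0 < e -> 0 < d ->
  exists (g : {scalar E}) (y : E), [/\ bounded_operator (g : E -> K^o),
    forall u, `|g (Q (A u))| <= e * `|u|, undominated g &
    [/\ vanish N y, `|y| <= d & 1 <= 2 * g y]].
Proof.
move=> e0 d0; pose B : {linear G -> E} := Q \o A.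
have B_bounded : bounded_operator B.
  have [M M0 QM] := bounded_operator_gt0 Q_bounded; have [L AL] := A_bounded.
  exists (M * L) => u; apply: (le_trans (QM _)).
  by rewrite -mulrA ler_pM2l.
have e20 : 0 < e / 2 by rewrite divr_gt0.
have [g [[M0 gM0] [gB [y [Vy yd gy]]]]] := exists_functional_small_on_range B_bounded
  vanish_linear (fun u => Q_vanish (A u)) QA_proper e20 d0.
have [gund|/existsNP[C0 gdom]] := pselect (undominated g).
  exists g, y; split=> //; [by exists M0| |by split=> //; lra].
  by move=> u; apply: (le_trans (gB u)); rewrite ler_wpM2r//; lra.
have [h [hb hund]] := exists_undominated.
have [M1 M10 hM1] := bounded_operator_gt0 hb.
have [M2 M20 BM2] := bounded_operator_gt0 B_bounded.
(* The first term keeps [a * h] below [e / 2 * |u|] at [B u]; the second keeps [|a * h y| <= 1/2],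
   so the value at [y] remains at least 1/2. *)
pose a := Num.min (e / 2 / (M1 * M2)) ((2 * (M1 * d))^-1).
have a0 : 0 < a by rewrite lt_min !divr_gt0 ?invr_gt0 ?mulr_gt0.
have [k kE] := combine g h a.
exists k, y; split.
- exists (M0 + a * M1) => z; rewrite kE mulrDl; apply: (le_trans (ler_normD _ _)).
  by rewrite lerD// normrM gtr0_norm// -mulrA ler_pM2l.
- move=> u; rewrite kE (splitr e) mulrDl; apply: (le_trans (ler_normD _ _)).
  rewrite lerD//; first exact: gB.
  rewrite normrM gtr0_norm//; apply: (le_trans (y := a * (M1 * (M2 * `|u|)))).
    by rewrite ler_pM2l// (le_trans (hM1 _))// ler_pM2l//; exact: BM2.
  by rewrite !mulrA ler_wpM2r// -mulrA -ler_pdivlMr ?mulr_gt0// ge_min lexx.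
(* The summand [|C0|] absorbs the loss [|g z| <= C0 * |T z|]. *)
- move=> C; have [z [Vz hz]] := hund ((`|C| + `|C0|) / a).
  exists z; split=> //; have gz : `|g z| <= C0 * `|T z|.
    by rewrite leNgt; apply/negP => gz; apply: gdom; exists z.
  have : `|a * h z| <= `|k z| + `|g z|.
    by rewrite (_ : a * h z = k z - g z) ?ler_normB// kE addrC addKr.
  rewrite normrM gtr0_norm//; move: hz.
  rewrite mulrAC ltr_pdivrMr// [`|h z| * a]mulrC mulrDl => hz.
  have := ler_wpM2r (normr_ge0 (T z)) (ler_norm C).
  have := ler_wpM2r (normr_ge0 (T z)) (ler_norm C0).
  by lra.
- split=> //; rewrite kE.
  have : `|a * h y| <= 2^-1; last by rewrite ler_norml => /andP[+ _]; lra.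
  rewrite normrM gtr0_norm//; apply: (le_trans (y := a * (M1 * d))).
    by rewrite ler_pM2l// (le_trans (hM1 _))// ler_pM2l.
  rewrite -ler_pdivlMr ?mulr_gt0// -invfM mulrC ge_min; apply/orP; right.
  by rewrite mulrC.
Qed.

(** Composition with [Q] makes the functional vanish at the earlier [x i]; density moves [y0] into
    the range of [A]. Density of [T] survives on the smaller kernel because [g] is undominated: a
    multiple of some [A t], with [g (A t)] huge compared to [T (A t)], cancels [g (A v)] while
    hardly moving [T (A v)]. *)
Lemma next_functional (e d : K) : 0 < e -> 0 < d ->
  exists (g : {scalar E}) (y : E),
    [/\ bounded_operator (g : E -> K^o), forall i, (i < N)%N -> g (x i) = 0,
        forall u, `|g (A u)| <= e * `|u| & `|y| <= d] /\
    [/\ g y = 1, vanish N y, exists u, A u = y & forall w r, 0 < r ->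
        exists u, [/\ vanish N (A u), g (A u) = 0 & `|w - T (A u)| < r]].
Proof.
move=> e0 d0; have d80 : 0 < d / 8 by rewrite divr_gt0.
have [g [y0 [gb gQA gund [Vy0 y0d gy0]]]] := exists_small_undominated e0 d80.
have [M M0 gM] := bounded_operator_gt0 gb.
have [L L0 QL] := bounded_operator_gt0 Q_bounded.
pose gQ : {scalar E} := g \o Q.
have gQE z : vanish N z -> gQ z = g z by move=> Vz; rewrite /= Q_id.
(* After projecting, the perturbation is at most [d / 8] and changes [g] by at most 1/4. So
   [|y1| <= d / 4] and [g y1 >= 1/4], and normalizing gives norm at most [d]. *)
pose r := Num.min (d / 8) ((4 * M)^-1) / L.
have r0 : 0 < r by rewrite divr_gt0// lt_min d80 invr_gt0 mulr_gt0.
have [u yu] := A_dense y0 r0.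
have y1d : `|y0 - Q (A u)| <= Num.min (d / 8) ((4 * M)^-1).
  rewrite -[y0 in leLHS]Q_id// -linearB; apply: (le_trans (QL _)).
  by rewrite mulrC -ler_pdivlMr// ltW.
move: y1d; rewrite le_min => /andP[y1d y1M].
pose y1 := Q (A u); have Vy1 : vanish N y1 by exact: Q_vanish.
have gy1 : 4^-1 <= g y1.
  have : `|g (y0 - y1)| <= 4^-1.
    apply: (le_trans (gM _)); rewrite -ler_pdivlMl//.
    by rewrite mulrC -invfM.
  rewrite linearB ler_norml => /andP[_]; move: gy0; lra.
have gy10 : 0 < g y1 by apply: lt_le_trans gy1; rewrite invr_gt0.
exists gQ, ((g y1)^-1 *: y1); split; split.
- exists (M * L) => z; apply: (le_trans (gM _)).
  by rewrite -mulrA ler_pM2l.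
- by move=> i iN; rewrite /= Q_x// linear0.
- by move=> v; exact: gQA.
- rewrite normrZ gtr0_norm ?invr_gt0// ler_pdivrMl//.
  have : `|y1| <= d / 4.
    have := ler_normB y0 (y0 - y1); rewrite subKr => /le_trans; apply.
    by move: y0d y1d; lra.
  by have := ler_wpM2r (ltW d0) gy1; lra.
- by rewrite linearZ_LR/= Q_id// mulVf// gt_eqF.
- by move=> i iN; rewrite linearZ_LR/= Vy1// mulr0.
- have [s us] := Q_range (A u); exists ((g y1)^-1 *: (u - s)).
  by rewrite linearZ/= linearB -us subKr.
- move=> w s s0; have s20 : 0 < s / 2 by rewrite divr_gt0.
  have [v [Vv vw]] := T_dense w s20.
  pose b := `|g (A v)| + 1; have b0 : 0 < b by rewrite ltr_wpDl.
  have [z [[Vz [t tz]] gz]] := gund (b / (s / 2)); rewrite -{}tz in Vz gz.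
  have gt0 : 0 < `|g (A t)| by apply: le_lt_trans gz; rewrite mulr_ge0// ltW// divr_gt0.
  have gtn0 : g (A t) != 0 by rewrite -normr_gt0.
  pose c := g (A v) / g (A t).
  have Vvt : vanish N (A (v - c *: t)).
    by rewrite addrC -scaleN1r scalerA linearP; apply: vanish_linear.
  exists (v - c *: t); split=> //.
    by rewrite gQE// linearB linearZ/= linearB linearZ_LR/= /c divfK ?subrr.
  have -> : w - T (A (v - c *: t)) = (w - T (A v)) + c *: T (A t).
    by rewrite linearB linearZ/= linearB linearZ/= opprB addrA addrAC.
  apply: (le_lt_trans (ler_normD _ _)); rewrite (splitr s) ltrD//.
  rewrite normrZ normrM normfV mulrAC ltr_pdivrMr//.
  move: gz; rewrite mulrAC ltr_pdivrMr// [_ * (s / 2)]mulrC.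
  by apply: le_lt_trans; rewrite ler_wpM2r// lerDl.
Qed.

End Step.

(** * Recursive construction of the biorthogonal system *)

Lemma history_choice (S : Type) (s0 : S) (P : nat -> (nat -> S) -> Prop) :
    (forall n u v, (forall i, (i < n)%N -> u i = v i) -> P n u -> P n v) ->
    (forall u, P 0 u) ->
    (forall n u, P n u -> exists a, P n.+1 (fun i => if i == n then a else u i)) ->
  exists u, forall n, P n u.
Proof.
move=> Pext P0 Pstep.
have [n_u|nxt hnxt] := @choice (nat * (nat -> S)) S (fun nu a => P nu.1 nu.2 ->
    P nu.1.+1 (fun i => if i == nu.1 then a else nu.2 i)).
  by have [/Pstep[a]|] := pselect (P n_u.1 n_u.2); [exists a|exists s0].
pose fix U n : nat -> S :=
  if n is m.+1 then fun i => if i == m then nxt (m, U m) else U m i else fun=> s0.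
have PU n : P n (U n) by elim: n => [//|n ih]; apply: (hnxt (n, U n)).
(* Entry [i] is fixed at stage [i + 1] and never changed, so the diagonal agrees with [U n] below
   [n], which is all that [P n] sees. *)
exists (fun i => U i.+1 i) => n; apply: Pext (PU n).
elim: n => [//|n ih] i; rewrite ltnS leq_eqVlt => /orP[/eqP-> //|ni].
by rewrite [LHS]/= (ltn_eqF ni) ih.
Qed.

Section Sequence.
Context (K : realType) (E F G : completeNormedModType K).
Context (T : {linear E -> F}) (A : {linear G -> E}).
Hypothesis T_bounded : bounded_operator T.
Hypothesis A_bounded : bounded_operator A.
Hypothesis A_dense : forall x e, 0 < e -> exists u, `|x - A u| < e.
Hypothesis A_proper : exists x, forall u, A u <> x.
Hypothesis TA_dense : forall w e, 0 < e -> exists u, `|w - T (A u)| < e.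
Hypothesis T_proper : exists w, forall x, T x <> w.

(* Takes every value infinitely often. *)
Definition target (n : nat) : nat := logn 2 n.+1.

(** The [A (u i)] are the points whose images approach [T (x (target i))]; the last clause will
    allow moving them into [X]. As [target i <= i], the first [n] triples determine the
    condition. *)
Definition stage (n : nat) (s : nat -> {scalar E} * E * G) : Prop :=
  let f i := (s i).1.1 in let x i := (s i).1.2 in let u i := (s i).2 in
  [/\ forall i, (i < n)%N -> bounded_operator (f i : E -> K^o),
      forall i j, (i < n)%N -> (j < n)%N -> f i (x j) = (i == j)%:R,
      forall i, (i < n)%N -> exists w, A w = x i &
      dense_on_vanish T A f n] /\
  [/\ forall i, (i < n)%N -> `|x i| <= 4^-1 ^+ i,
      forall i w, (i < n)%N -> `|f i (A w)| <= `|w|,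
      forall i, (i < n)%N -> vanish f i.+1 (A (u i)),
      forall i, (i < n)%N -> `|T (x (target i)) - T (A (u i))| <= 2^-1 ^+ i &
      forall i j, (i < j)%N -> (j < n)%N -> `|f j (A (u i))| <= 1].

Let target_le n : (target n <= n)%N.
Proof. by rewrite -ltnS /target ltn_logl. Qed.

Let stage_ext n s t : (forall i, (i < n)%N -> s i = t i) -> stage n s -> stage n t.
Proof.
move=> st [[fb bi xA D] [xs fA uV uT fu]]; split; split.
- by move=> i ni; rewrite -st//; exact: fb.
- by move=> i j ni nj; rewrite -!st//; exact: bi.
- by move=> i ni; rewrite -st//; exact: xA.
- move=> w e e0; have [u [Vu uw]] := D w e e0; exists u; split=> // i ni.
  by rewrite -st//; exact: Vu.
- by move=> i ni; rewrite -st//; exact: xs.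
- by move=> i w ni; rewrite -st//; exact: fA.
- move=> i ni j ji; rewrite -!st//; first exact: uV.
  by rewrite (leq_trans ji).
- move=> i ni; rewrite -!st//; first exact: uT.
  by rewrite (leq_ltn_trans (target_le i)).
- by move=> i j ij nj; rewrite -!st//; [exact: fu|rewrite (ltn_trans ij)].
Qed.

Lemma exists_sequence : exists (f : nat -> {scalar E}) (x : nat -> E) (u : nat -> G),
  [/\ forall i, bounded_operator (f i : E -> K^o),
      forall i j, f i (x j) = (i == j)%:R,
      forall i, `|x i| <= 4^-1 ^+ i &
      forall i w, `|f i (A w)| <= `|w|] /\
  [/\ forall i, vanish f i.+1 (A (u i)),
      forall i, `|T (x (target i)) - T (A (u i))| <= 2^-1 ^+ i &
      forall i j, (i < j)%N -> `|f j (A (u i))| <= 1].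
Proof.
suff [s hs] : exists s, forall n, stage n s.
  exists (fun i => (s i).1.1), (fun i => (s i).1.2), (fun i => (s i).2).
  split; split.
  - by move=> i; have [[+ _ _ _] _] := hs i.+1; exact.
  - move=> i j; have [[_ + _ _] _] := hs (maxn i j).+1; apply; rewrite ltnS.
      exact: leq_maxl.
    exact: leq_maxr.
  - by move=> i; have [_ [+ _ _ _ _]] := hs i.+1; exact.
  - by move=> i w; have [_ [_ + _ _ _]] := hs i.+1; exact.
  - by move=> i; have [_ [_ _ + _ _]] := hs i.+1; exact.
  - by move=> i; have [_ [_ _ _ + _]] := hs i.+1; exact.
  - by move=> i j ij; have [_ [_ _ _ _ +]] := hs j.+1; exact.
apply: (@history_choice _ ((\0 : {scalar E}), (0 : E), (0 : G)) stage stage_ext).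
  move=> s; do 2 split=> //.
  by move=> w e e0; have [u uw] := TA_dense w e0; exists u.
move=> n s [[fb bi xA D] [xs fA uV uT fu]].
(* The bound [1 / M] on the new functional serves twice: [M >= 1] gives [|f n (A w)| <= |w|], and
   [M >= |u i|] gives [|f n (A (u i))| <= 1]. *)
pose M := 1 + \sum_(i < n) `|(s i).2|.
have M1 : 1 <= M by rewrite lerDl sumr_ge0.
have M0 : 0 < M by rewrite (lt_le_trans _ M1).
have d0 : 0 < 4^-1 ^+ n :> K by rewrite exprn_gt0// invr_gt0.
have iM0 : 0 < M^-1 by rewrite invr_gt0.
have [g [y [[gb gx gA yd] [gy Vy [w0 yA] gD]]]] := next_functional T_bounded A_bounded
  A_dense A_proper T_proper fb bi xA D iM0 d0.
(* [target n] may be [n] itself, and then the new vector [y] is meant. *)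
pose xn i := if i == n then y else (s i).1.2.
have r0 : 0 < 2^-1 ^+ n :> K by rewrite exprn_gt0// invr_gt0.
have [t [Vt gt tT]] := gD (T (xn (target n))) _ r0.
exists (g, y, t).
have case_lt i : (i < n.+1)%N -> i = n \/ (i < n)%N /\ (i == n) = false.
  by rewrite ltnS leq_eqVlt => /orP[/eqP|ni]; [left|right; rewrite ltn_eqF].
split; split.
- move=> i /case_lt[->|[ni ->]]; first by rewrite eqxx.
  exact: fb.
- move=> i j /case_lt[->|[ni ->]] /case_lt[->|[nj ->]]; rewrite ?eqxx//.
  + by rewrite gx// eq_sym (ltn_eqF nj).
  + by rewrite Vy// (ltn_eqF ni).
  + exact: bi.
- move=> i /case_lt[->|[ni ->]]; first by rewrite eqxx; exists w0.
  exact: xA.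
- move=> w e e0; have [v [Vv gv vw]] := gD w e e0; exists v; split=> // i.
  move=> /case_lt[->|[ni ->]]; first by rewrite eqxx.
  exact: Vv.
- move=> i /case_lt[->|[ni ->]]; first by rewrite eqxx.
  exact: xs.
- move=> i w /case_lt[->|[ni ->]]; last exact: fA.
  rewrite eqxx/=; apply: (le_trans (gA w)).
  by rewrite ler_piMl// invf_le1.
- move=> i /case_lt[->|[ni ->]] j.
    by move=> /case_lt[->|[nj ->]]; rewrite eqxx//; exact: Vt.
  rewrite ltnS => ji; rewrite (ltn_eqF (leq_ltn_trans ji ni)).
  exact: uV.
- move=> i /case_lt[->|[ni ->]].
    rewrite eqxx/=; have := ltW tT; rewrite /xn.
    by case: eqP.
  rewrite (ltn_eqF (leq_ltn_trans (target_le i) ni)).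
  exact: uT.
- move=> i j ij /case_lt[jn|[nj jn]].
    rewrite jn eqxx; rewrite jn in ij; rewrite (ltn_eqF ij)/=.
    apply: (le_trans (gA _)); rewrite ler_pdivrMl// mulr1 /M.
    by rewrite (bigD1 (Ordinal ij))//= addrCA lerDl addr_ge0// sumr_ge0.
  rewrite jn (ltn_eqF (ltn_trans ij nj)).
  exact: fu.
Qed.

End Sequence.

(** * The common kernel of the functionals and its quotient *)

Lemma exists_target (j p : nat) : exists2 k, (p <= k)%N & target k = j.
Proof.
(* The odd factor [2p + 1] leaves the 2-adic valuation of [k + 1] equal to [j] and makes [k] at
   least [p]. *)
exists (2 ^ j * p.*2.+1).-1; last first.
  rewrite /target prednK ?muln_gt0 ?expn_gt0// lognM ?expn_gt0// pfactorK//.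
  by rewrite lognE/= dvdn2/= odd_double addn0.
rewrite -ltnS prednK ?muln_gt0 ?expn_gt0//; apply: (@leq_trans p.*2.+1).
  by rewrite ltnS -addnn leq_addr.
by rewrite leq_pmull// expn_gt0.
Qed.

Lemma denseP (K : realType) (E : normedModType K) (D : set E) :
  dense D <-> forall x e, 0 < e -> exists2 y, D y & `|x - y| < e.
Proof.
split=> [Dd x e e0|Dd O [x Ox] Oo].
  have [||y [xy Dy]] := Dd (ball x e); first by exists x; exact: ballxx.
    exact: ball_open.
  by exists y => //; move: xy; rewrite -ball_normE.
have [e /= e0 eO] := (nbhs_ballP _ _).1 (open_nbhs_nbhs (conj Oo Ox)).
by have [y Dy xy] := Dd x e e0; exists y; split=> //; apply: eO; rewrite -ball_normE.
Qed.

Lemma common_kernel_closed_subspace (K : realType) (E : normedModType K)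
    (f : nat -> {scalar E}) : (forall i, bounded_operator (f i : E -> K^o)) ->
  exists X : closedSubspaceType E, forall z, z \in X <-> forall i, f i z = 0.
Proof.
move=> fb; pose S : {pred E} := fun z => `[< forall i, f i z = 0 >].
have Ssub : GRing.subsemimod_closed S.
  split; [split|].
  - by apply/asboolP => i; rewrite linear0.
  - by move=> y z /asboolP yS /asboolP zS; apply/asboolP => i; rewrite linearD yS zS addr0.
  - by move=> a z /asboolP zS; apply/asboolP => i; rewrite linearZ_LR/= zS mulr0.
have Scl : closed [set` S].
  move=> z zS; apply/asboolP => i; apply/eqP; rewrite -normr_le0.
  have [M M0 fM] := bounded_operator_gt0 (fb i).
  apply: (@le_all_gt0 _ _ _ M) => e e0; have [y [/asboolP yS]] := zS _ (nbhsx_ballx z e e0).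
  rewrite -ball_normE /ball_/= => zy; rewrite add0r -[f i z]subr0 -(yS i) -linearB.
  by apply: (le_trans (fM _)); rewrite ler_pM2l// ltW.
pose X : closedSubspaceType E :=
  HB.pack S (GRing.isSubmodClosed.Build K E S Ssub) (isClosedPred.Build E S Scl).
by exists X => z; split=> [/asboolP|zS]; [exact|apply/asboolP].
Qed.

(** [E/B] is a quotient of [E/A], so finite spanning families descend. With [X] inside [R + X],
    infinite dimension of [E/X] follows from (b). *)
Lemma infinite_dimensional_lquot (K : nzRingType) (E : lmodType K) (A B : submodClosed E) :
  {subset A <= B} -> infinite_dimensional (lquot B) -> infinite_dimensional (lquot A).
Proof.
move=> AB Binf [n [v vA]]; apply: Binf; have [w hw] := choice (fun i => lquot_pi_surj (v i)).
exists n, (fun i => lquot_pi B (w i)) => q; have [z <-] := lquot_pi_surj q.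
have [c hc] := vA (lquot_pi A z); exists c.
have -> : \sum_(i < n) c i *: lquot_pi B (w i) = lquot_pi B (\sum_(i < n) c i *: w i).
  by rewrite linear_sum/=; apply: eq_bigr => i _; rewrite linearZ.
apply/lquot_piE/AB/lquot_piE; rewrite hc linear_sum/=.
by apply: eq_bigr => i _; rewrite linearZ/= hw.
Qed.

Section Biorthogonal.
Context (K : realType) (E G : completeNormedModType K) (A : {linear G -> E}).
Hypothesis A_dense : forall x e, 0 < e -> exists u, `|x - A u| < e.
Context (f : nat -> {scalar E}) (x : nat -> E).
Hypothesis f_bounded : forall i, bounded_operator (f i : E -> K^o).
Hypothesis biorthogonal : forall i j, f i (x j) = (i == j)%:R.
Hypothesis x_small : forall i, `|x i| <= 4^-1 ^+ i.
Hypothesis fA : forall i w, `|f i (A w)| <= `|w|.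
Context (X : closedSubspaceType E) (XE : forall z, z \in X <-> forall i, f i z = 0).

Let half_ge0 : 0 <= 2^-1 :> K. Proof. by rewrite invr_ge0. Qed.

Let f_sum (a : nat -> K) n i :
  f i (\sum_(j < n) a j *: x j) = if (i < n)%N then a i else 0.
Proof.
rewrite linear_sum/=; case: ifPn => [ni|]; last first.
  rewrite -leqNgt => ni; rewrite big1// => j _; rewrite linearZ_LR/= biorthogonal.
  by rewrite gtn_eqF ?mulr0// (leq_trans (ltn_ord j)).
rewrite (bigD1 (Ordinal ni))//= linearZ_LR/= biorthogonal eqxx mulr1.
rewrite big1 ?addr0// => j ij; rewrite linearZ_LR/= biorthogonal.
by rewrite (_ : (i == j) = false) ?mulr0//; apply/negbTE; rewrite eq_sym; exact: ij.
Qed.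

(** The series of the [a j *: x j] converges, its terms being at most [C * 2^j * 4^-j = C * 2^-j];
    if the first [m] coefficients vanish, the sum is a tail. *)
Lemma interpolate (a : nat -> K) (C : K) : (forall j, `|a j| <= C * 2 ^+ j) ->
  exists y, (forall j, f j y = a j) /\
    forall m, (forall j, (j < m)%N -> a j = 0) -> `|y| <= 2 * C * 2^-1 ^+ m.
Proof.
move=> aC; pose s n := \sum_(j < n) a j *: x j.
have sS n : `|s n.+1 - s n| <= C * 2^-1 ^+ n.
  rewrite /s big_ord_recr/= addrAC subrr add0r normrZ.
  apply: (le_trans (ler_pM _ _ (aC n) (x_small n))) => //.
  by rewrite -mulrA -exprMn (_ : 2 * 4^-1 = 2^-1)//; field.
have [y hy] := geometric_cauchy half_ge0 (lexx _) sS.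
exists y; split=> [j|m am]; last first.
  by have := hy m; rewrite /s big1 ?subr0// => j _; rewrite am// scale0r.
have [M M0 fM] := bounded_operator_gt0 (f_bounded j).
apply/eqP; rewrite -subr_eq0 -normr_le0.
apply: (@le_expr_half _ 2^-1 _ _ (M * (2 * C * 2^-1 ^+ j.+1))) => // n.
(* From index [j + 1] on, the partial sums contain the term of index [j]. *)
have -> : f j y - a j = f j (y - s (j.+1 + n)%N).
  by rewrite linearB f_sum leq_addr.
by rewrite add0r (le_trans (fM _))// -!mulrA ler_pM2l// -exprD !mulrA hy.
Qed.

(** Subtracting the interpolating vector with the same values [f j z] lands in [X], and that vector
    is small. *)
Lemma near_common_kernel (z : E) (C : K) (m : nat) : (forall j, `|f j z| <= C) ->
  (forall j, (j < m)%N -> f j z = 0) -> exists2 y, y \in X & `|z - y| <= 2 * C * 2^-1 ^+ m.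
Proof.
move=> zC zm; have C0 : 0 <= C by apply: le_trans (zC 0).
have [|y [fy ym]] := @interpolate (fun j => f j z) C.
  move=> j; apply: (le_trans (zC j)); rewrite ler_peMr// exprn_ege1//.
  by rewrite ler1n.
exists (z - y); last by rewrite subKr; exact: ym.
by apply/XE => i; rewrite linearB fy subrr.
Qed.

(** Modulo [X], each [A u] is the limit of its partial expansions, since its coefficients are
    bounded by [|u|]. *)
Lemma near_partial_sum (u : G) (m : nat) :
  exists2 y, y \in X & `|A u - \sum_(j < m) f j (A u) *: x j - y| <= 2 * `|u| * 2^-1 ^+ m.
Proof.
apply: near_common_kernel => j; rewrite linearB (f_sum (fun j => f j (A u))).
  by case: ifP; rewrite ?subrr ?normr0// subr0.
by move=> ->; rewrite subrr.
Qed.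

(** Classes of finite rational combinations of the [x j] are dense. Replacing [z] by [A u], [A u] by
    a partial expansion modulo [X], and the coefficients by rationals costs at most [e / 4] each. *)
Lemma separable_common_kernel_quotient : separable (nquot X).
Proof.
pose r (s : seq rat) := \sum_(j < size s) ratr s`_j *: x j.
exists (range (fun s => nquot_pi X (r s))).
  exact: sub_countable (card_image_le _ _) (countableP _).
apply/denseP => q e e0; have [z <-] := lquot_pi_surj q.
have e40 : 0 < e / 4 by rewrite divr_gt0.
have [u zu] := A_dense z e40.
have [m um] : exists m, 2 * `|u| * 2^-1 ^+ m <= e / 4.
  have u0 : 0 < 2 * (`|u| + 1) by rewrite mulr_gt0// ltr_wpDl.
  have [m hm] := expr_half_small half_ge0 (lexx _) (divr_gt0 e40 u0).
  exists m; move: hm; rewrite ltr_pdivlMr// mulrC => /ltW; apply: le_trans.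
  by rewrite ler_wpM2r ?exprn_ge0// ler_pM2l// lerDl.
have [y yX uy] := near_partial_sum u m.
(* There are [m] coefficients and [|x j| <= 1]; [m + 1] avoids division by zero. *)
have d0 : 0 < e / 4 / m.+1%:R by rewrite !divr_gt0.
have /choice[a ha] : forall j, exists a : rat, `|f j (A u) - ratr a| < e / 4 / m.+1%:R.
  move=> j; have [_ [b _ <-] ab] := (denseP _).1 (@dense_rat K) (f j (A u)) _ d0.
  by exists b.
exists (nquot_pi X (r (mkseq a m))); first by exists (mkseq a m).
have -> : lquot_pi X z - nquot_pi X (r (mkseq a m)) = nquot_pi X (z - r (mkseq a m) - y).
  rewrite -[lquot_pi X z]/(nquot_pi X z) -(linearB (nquot_pi X)); apply/lquot_piE.
  by rewrite opprB addrCA subrr addr0.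
rewrite nquot_normE.
apply: (le_lt_trans (quotient_norm_le X _)).
have rE : r (mkseq a m) = \sum_(j < m) ratr (a j) *: x j.
  by rewrite /r size_mkseq; apply: eq_bigr => j _; rewrite nth_mkseq.
have sumE : `|\sum_(j < m) f j (A u) *: x j - r (mkseq a m)| <= e / 4.
  rewrite rE -sumrB; apply: (le_trans (ler_norm_sum _ _ _)).
  apply: (le_trans (y := \sum_(j < m) e / 4 / m.+1%:R)).
    apply: ler_sum => j _; rewrite -scalerBl normrZ -[leRHS]mulr1 ler_pM ?(ltW (ha j))//.
    by rewrite (le_trans (x_small j))// exprn_ile1// ?invr_ge0// invf_le1// ler1n.
  rewrite sumr_const card_ord -[_ *+ m]mulr_natr -mulrA.
  by apply: ler_piMr; [exact: ltW|rewrite mulrC ler_pdivrMr// mul1r ler_nat].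
have -> : z - r (mkseq a m) - y = (z - A u) +
    ((A u - \sum_(j < m) f j (A u) *: x j - y) +
     (\sum_(j < m) f j (A u) *: x j - r (mkseq a m))).
  rewrite [A u - _ - y]addrAC subrKA -[A u - y - _]addrA subrKA addrA.
  by rewrite [RHS]addrAC.
apply: (le_lt_trans (ler_normD _ _)).
have := ler_normD (A u - \sum_(j < m) f j (A u) *: x j - y)
  (\sum_(j < m) f j (A u) *: x j - r (mkseq a m)).
by lra.
Qed.

(** On [R + X] the sequence [f k] is bounded. A nontrivial combination of the [y j] violates this,
    because [y j] has values [2^k] on the infinite set where [target k = j] and 0 elsewhere. *)
Lemma infinite_codim_sum_common_kernel (R : submodClosed E) : range A = [set` R] ->
  infinite_codim (subspace_sum R X).
Proof.
move=> AR [n [v vspan]].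
have /choice[y hy] : forall j : nat, exists y, forall k, f k y = (target k == j)%:R * 2 ^+ k.
  move=> j; have [|y [hy _]] := @interpolate (fun k => (target k == j)%:R * 2 ^+ k) 1.
    move=> k; case: eqP => _; last by rewrite mul0r mul1r normr0 exprn_ge0.
    by rewrite !mul1r ger0_norm ?exprn_ge0.
  by exists y.
have /choice[c hc] : forall j : 'I_n.+1, exists c : 'I_n -> K,
    lquot_pi (subspace_sum R X) (y j) = \sum_(i < n) c i *: v i.
  by move=> j; exact: vspan.
(* Having [n + 1] rows and [n] columns, [C] has a nonzero left kernel, which gives a nontrivial
   combination [w] in [R + X]. *)
pose C := \matrix_(j < n.+1, i < n) c j i.
have : kermx C != 0.
  rewrite kermx_eq0 /row_free; apply/negP => /eqP Cn.
  by have := rank_leq_col C; rewrite Cn ltnn.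
move=> /rowV0Pn[l /sub_kermxP lC l0].
pose w := \sum_(j < n.+1) l 0 j *: y j.
have wE : lquot_pi (subspace_sum R X) w = lquot_pi (subspace_sum R X) 0.
  rewrite /w linear_sum linear0/=.
  under eq_bigr do rewrite linearZ/= hc scaler_sumr.
  rewrite exchange_big/= big1// => i _.
  under eq_bigr do rewrite scalerA.
  rewrite -scaler_suml [X in X *: _](_ : _ = 0) ?scale0r//.
  transitivity ((l *m C) 0 i); last by rewrite lC mxE.
  by rewrite mxE; apply: eq_bigr => j _; rewrite mxE.
move/lquot_piE: wE; rewrite subr0 => /subspace_sumP[a [b [aR bX wab]]].
have [u _ uA] : range A a by rewrite AR.
have fw k : `|f k w| <= `|u|.
  by rewrite wab linearD ((XE b).1 bX) addr0 -uA.
have [j lj] : exists j, l 0 j != 0 by apply/rV0Pn.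
have [p up] : exists p : nat, `|u| / `|l 0 j| < p%:R.
  by exists (Num.truncn (`|u| / `|l 0 j|)).+1; rewrite truncnS_gt.
have [k pk kj] := exists_target j p.
have := fw k; apply/negP; rewrite -ltNge.
have -> : f k w = l 0 j * 2 ^+ k.
  rewrite /w linear_sum/= (bigD1 j)//= linearZ_LR/= hy kj eqxx mul1r.
  rewrite big1 ?addr0// => i ij; rewrite linearZ_LR/= hy kj.
  rewrite (_ : (j == i :> nat) = false) ?mul0r ?mulr0//.
  by apply/negbTE; rewrite eq_sym; exact: ij.
rewrite normrM mulrC -ltr_pdivrMr ?normr_gt0// (lt_le_trans up)//.
by rewrite ger0_norm ?exprn_ge0// -natrX ler_nat (leq_trans pk)// ltnW// ltn_expl.
Qed.

(** The functional [h \o T] vanishes first at every [x j], as [T (x j)] is a limit of points of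
    [T(X)], then on the range of [A] by partial expansions, and finally on [E] by density. *)
Lemma annihilator_common_kernel (F : normedModType K) (T : {linear E -> F}) (u : nat -> G)
    (h : F -> K) :
    bounded_operator T -> dual h ->
    (forall i, vanish f i.+1 (A (u i))) ->
    (forall i, `|T (x (target i)) - T (A (u i))| <= 2^-1 ^+ i) ->
    (forall i j, (i < j)%N -> `|f j (A (u i))| <= 1) ->
    (forall z, z \in X -> h (T z) = 0) ->
  forall z, h (T z) = 0.
Proof.
move=> T_bounded /dual_scalar[k [N [N0 <- hN]]] uV uT fu hX.
have [M M0 TM] := bounded_operator_gt0 T_bounded.
have hTX z y c : y \in X -> `|z - y| <= c -> `|k (T z)| <= N * (M * c).
  move=> yX zc; rewrite -[k (T z)]subr0 -(hX y yX) -!linearB.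
  by rewrite (le_trans (hN _))// ler_wpM2l// (le_trans (TM _))// ler_pM2l.
have hx j : k (T (x j)) = 0.
  apply/eqP; rewrite -normr_le0.
  apply: (@le_expr_half _ 2^-1 _ _ (N + N * (M * 2))) => // p.
  have [i pi ij] := exists_target j p.
  (* The functionals up to index [i] vanish at [A (u i)] and the later ones are at most 1, so its
     distance to [X] is at most [2^-i]. *)
  have [||y yX uy] := @near_common_kernel (A (u i)) 1 i.+1.
  - move=> q; have [iq|qi] := ltnP i q; first exact: fu.
    by rewrite uV// normr0.
  - exact: uV.
  have ip : 2^-1 ^+ i <= 2^-1 ^+ p :> K.
    by apply: ler_wiXn2l => //; rewrite invf_le1// ler1n.
  have iSp : 2^-1 ^+ i.+1 <= 2^-1 ^+ p :> K.
    by apply: ler_wiXn2l; rewrite ?(leq_trans pi)// invf_le1// ler1n.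
  rewrite -ij -[T (x _)](subrK (T (A (u i)))) linearD/= add0r mulrDl.
  apply: (le_trans (ler_normD _ _)); apply: lerD.
    by rewrite (le_trans (hN _))// ler_wpM2l// (le_trans (uT i)).
  apply: (le_trans (hTX _ _ _ yX uy)); rewrite mulr1 -!mulrA ler_wpM2l//.
  by rewrite ler_pM2l// ler_pM2l.
have hA w : k (T (A w)) = 0.
  apply/eqP; rewrite -normr_le0.
  apply: (@le_expr_half _ 2^-1 _ _ (N * (M * (2 * `|w|)))) => // m.
  have [y yX wy] := near_partial_sum w m.
  have -> : k (T (A w)) = k (T (A w - \sum_(j < m) f j (A w) *: x j)).
    rewrite !linearB linear_sum linear_sum/= big1 ?subr0// => j _.
    by rewrite linearZ/= linearZ_LR/= hx mulr0.
  by rewrite add0r (le_trans (hTX _ _ _ yX wy))// !mulrA.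
move=> z; apply/eqP; rewrite -normr_le0.
apply: (@le_all_gt0 _ _ _ (N * M)) => e e0; have [w zw] := A_dense z e0.
rewrite add0r -[k (T z)]subr0 -(hA w) -!linearB (le_trans (hN _))// -mulrA.
by rewrite ler_wpM2l// (le_trans (TM _))// ler_pM2l// ltW.
Qed.

End Biorthogonal.

(** * Assembly of (a), (b) and (c) *)

Theorem corollary3p7 (K : realType) (E F : completeNormedModType K)
    (hE : has_separable_quotient E)
    (T : {linear E -> F}) (T_bounded : bounded_operator T)
    (T_dense : dense (range T))
    (R : submodClosed E) (hR : proper_dense_operator_range R)
    (T_not_closed : ~ closed (range T)) :
  exists X : closedSubspaceType E,
    [/\ separable (nquot X) /\ infinite_dimensional (nquot X),
        infinite_codim (subspace_sum R X)
      & (adjoint T @` @dual K F) `&` annihilator [set` X] = [set 0]].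
Proof.
have [[G [A [A_bounded AR]]] R_dense R_proper] := hR.
have A_dense z e : 0 < e -> exists u, `|z - A u| < e.
  move: R_dense; rewrite -AR => /denseP Ad e0.
  by have [_ [u _ <-] zu] := Ad z e e0; exists u.
have A_proper : exists z, forall u, A u <> z.
  apply: contrapT => Aall; apply: R_proper; rewrite -AR -subTset => z _.
  by apply: contrapT => zA; apply: Aall; exists z => u uz; apply: zA; exists u.
have T_proper : exists w, forall z, T z <> w.
  apply: contrapT => Tall; apply: T_not_closed.
  suff -> : range T = setT by exact: closedT.
  rewrite -subTset => w _; apply: contrapT => wT.
  by apply: Tall; exists w => z zw; apply: wT; exists z.
have TA_dense w e : 0 < e -> exists u, `|w - T (A u)| < e.
  move=> e0; have e20 : 0 < e / 2 by rewrite divr_gt0.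
  have [M M0 TM] := bounded_operator_gt0 T_bounded.
  have [_ [z _ <-] wz] := (denseP _).1 T_dense w _ e20.
  have [u zu] := A_dense z _ (divr_gt0 e20 M0).
  exists u; rewrite (splitr e) -[w](subrK (T z)) -addrA -linearB.
  rewrite (le_lt_trans (ler_normD _ _))// ltrD// (le_lt_trans (TM _))//.
  by rewrite mulrC -ltr_pdivlMr.
have [f [x [u [[fb fx xs fA] [uV uT fu]]]]] :=
  exists_sequence T_bounded A_bounded A_dense A_proper TA_dense T_proper.
have [X XE] := common_kernel_closed_subspace fb.
have RX : infinite_codim (subspace_sum R X).
  exact: (infinite_codim_sum_common_kernel fb fx xs fA XE AR).
exists X; split=> //; first split.
- exact: (separable_common_kernel_quotient A_dense fb fx xs fA XE).
- apply: infinite_dimensional_lquot RX => z zX; apply/subspace_sumP.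
  by exists 0, z; rewrite rpred0 add0r.
- apply/seteqP; split=> [_ [[h hdual <-] [_ hX]]|_ ->].
    apply/funext => z; rewrite /adjoint/=.
    exact: (annihilator_common_kernel A_dense fb fx xs fA XE T_bounded hdual uV uT fu).
  have dual0 (V : normedModType K) : dual (0 : V -> K).
    split=> [a y z|]; first by rewrite mulr0 addr0.
    by exists 0 => z; rewrite normr0 mul0r.
  split; first by exists 0 => //; exact/funext.
  by split.
Qed.
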